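(* For every topological space $X$, $$|X|\le nu(X)^{\kappa(X)\, aL(X)}.$$
   Context: No separation axioms are assumed. $\overline{U}$ denotes the closure of $U$ in $X$, and $\mathcal{N}_x$ denotes the family of all open neighborhoods of $x$ in $X$. The exponent $\kappa(X)\,aL(X)$ is the product of cardinals. $\kappa(X)$ is the smallest infinite cardinal $\kappa$ such that for each $x\in X$ there is a collection $\mathcal{V}_x$ of closed neighborhoods of $x$ (closed sets containing $x$ in their interior) with $|\mathcal{V}_x|\le\kappa$ such that for every $W\in\mathcal{N}_x$ the set $\overline{W}$ contains a member of $\mathcal{V}_x$. The almost Lindel\''of degree $aL(X)$ is the smallest infinite cardinal $\tau$ such that for every open cover $\mathcal{U}$ of $X$ there is $\mathcal{U}_0\subset\mathcal{U}$ with $|\mathcal{U}_0|\le\tau$ and $X=\bigcup\{\overline{U}:U\in\mathcal{U}_0\}$. A nonempty set $M\subset X$ is finitely non-Urysohn if for every nonempty finite $F\subset M$ and every choice of open neighborhoods $U_x\in\mathcal{N}_x$ ($x\in F$), $\bigcap_{x\in F}\overline{U_x}\ne\emptyset$. The non-Urysohn number of $X$ is the cardinal $nu(X)=1+\sup\{|M|: M \text{ is a finitely non-Urysohn subset of } X\}$; it may be finite. *)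

(* Defs.v *)
From mathcomp Require Import all_boot.
From mathcomp Require Import boolp classical_sets functions cardinality.
From mathcomp Require Import topology.

Set Implicit Arguments.
Unset Strict Implicit.
Unset Printing Implicit Defensive.

Local Open Scope classical_set_scope.
Local Open Scope card_scope.

(* A cardinal is represented by a type of that cardinality: products and powers
   of cardinals are product and function types, and 1 + |S| is [option S].  The
   types [kappa X], [aL X] and [nu X] below are thus only meaningful up to
   equipotence. *)

Definition is_least_cardinal (P : Type -> Prop) (K : Type) : Prop :=
  P K /\ forall L : Type, P L -> [set: K] #<= [set: L].

Lemma minset_card (B : Type) (Q : set (set B)) : Q !=set0 ->
  exists2 A, Q A & forall A', Q A' -> A #<= A'.
Proof.
move=> [A0 QA0].
pose I := {A : set B | Q A}.
pose i0 : I := exist _ A0 QA0.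
pose ok (F : set (I -> B)) :=
  (forall f i, F f -> sval i (f i)) /\
  (forall f g i, F f -> F g -> f i = g i -> f = g).
have [G sG totG|F [[Fin Finj] Fmax]] := @Zorn_bigcup _ ok.
  split=> [f i [H GH Hf]|f g i [H GH Hf] [K GK Kg] fg].
    by have [+ _] := sG _ GH; apply.
  have [HK|KH] := totG _ _ GH GK.
    by have [_] := sG _ GK; apply; [exact: HK|exact: Kg|exact: fg].
  by have [_] := sG _ GH; apply; [exact: Hf|exact: KH|exact: fg].
have [[i iF]|nF] :=
    pselect (exists i : I, sval i `<=` [set f i | f in F]).
  exists (sval i) => [|A' QA']; first exact: (svalP i).
  apply: card_le_trans (subset_card_le iF) _.
  apply: card_le_trans (card_image_le _ _) _.
  pose j : I := exist _ A' QA'.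
  have injj : {in F &, injective (fun f : I -> B => f j)}.
    by move=> f g /set_mem Ff /set_mem Fg; exact: Finj.
  rewrite -(card_le_eql (inj_card_eq injj)).
  by apply: subset_card_le => _ [f Ff <-]; exact: (Fin f j Ff).
have /choice[f fP] : forall i : I, exists b, sval i b /\ ~ [set f i | f in F] b.
  move=> i; apply: contrapT => H; apply: nF; exists i => b ib.
  by apply: contrapT => Fb; apply: H; exists b.
exfalso; apply: (Fmax (F `|` [set f])).
  split; first by move=> g Fg; left.
  by move=> /(_ f (or_intror erefl)) Ff; case: (fP i0) => _; apply; exists f.
split=> [g i [Fg| ->]|g h i [Fg| ->] [Fh| ->] // gh].
- exact: Fin.
- exact: (fP i).1.
- exact: Finj gh.
- by case: (fP i) => _ []; exists g.
- by case: (fP i) => _ []; exists h.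
Qed.

Lemma card_le_total (T U : Type) : [set: T] #<= [set: U] \/ [set: U] #<= [set: T].
Proof.
pose l := range (@inl T U); pose r := range (@inr T U).
have lT : l #= [set: T] by apply: inj_card_eq => x y _ _ [].
have rU : r #= [set: U] by apply: inj_card_eq => x y _ _ [].
have [|A [-> | ->] Amin] := @minset_card _ [set l; r]; first by exists l; left.
  by left; rewrite -(card_le_eql lT) -(card_le_eqr rU); apply: Amin; right.
by right; rewrite -(card_le_eql rU) -(card_le_eqr lT); apply: Amin; left.
Qed.

Lemma least_cardinal_exists (P : Type -> Prop) (B : Type) :
  (forall K L : Type, [set: K] #= [set: L] -> P K -> P L) -> P B ->
  exists K, is_least_cardinal P K.
Proof.
move=> Pinv PB.
have setTE (T : Type) (A : set T) : [set: A] #= A by exact: card_setT.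
have [|A PA Amin] := @minset_card B [set A | P (set_type A)].
  by exists setT; apply: Pinv PB; rewrite card_eq_sym; exact: setTE.
exists (set_type A); split=> // L PL; rewrite (card_le_eql (setTE _ A)).
have [BL|LB] := card_le_total B L.
  exact: card_le_trans (card_leT _) BL.
have /card_subP[A' A'L _] := LB.
rewrite -(card_le_eqr A'L); apply: Amin; apply: Pinv PL.
by rewrite (card_eqr (setTE _ _)) card_eq_sym.
Qed.

Lemma inj_card_leT (T U : Type) (f : T -> U) :
  injective f -> [set: T] #<= [set: U].
Proof.
move=> finj; apply/card_subP; exists (range f) => //.
by apply: inj_card_eq => x y _ _; exact: finj.
Qed.

Lemma card_eq_infinite (K L : Type) :
  [set: K] #= [set: L] -> infinite_set [set: K] -> infinite_set [set: L].
Proof.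
move=> KL Kinf Lfin; apply: Kinf.
by apply: card_le_finite Lfin; rewrite (card_le_eql KL).
Qed.

Lemma infinite_sum_nat (T : Type) : infinite_set [set: (T + nat)%type].
Proof. by apply/infiniteP; apply: (@inj_card_leT _ _ inr) => x y []. Qed.

Lemma card_le_sum_nat (T : Type) (A : set T) : A #<= [set: (T + nat)%type].
Proof.
apply: card_le_trans (card_leT _) _.
by apply: (@inj_card_leT _ _ inl) => x y [].
Qed.

Section CardinalFunctions.
Variable X : topologicalType.
Implicit Types (x : X) (F M : set X) (U V : set (set X)) (K : Type).

Definition closed_nbhd x F : Prop := closed F /\ (interior F) x.

Definition kappa_bound K : Prop :=
  infinite_set [set: K] /\
  forall x, exists V,
    [/\ V #<= [set: K],
        (forall F, V F -> closed_nbhd x F) &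
        forall W : set X, open_nbhs x W -> exists2 F, V F & F `<=` closure W].

Definition aL_bound K : Prop :=
  infinite_set [set: K] /\
  forall U, (forall A, U A -> open A) -> \bigcup_(A in U) A = [set: X] ->
    exists U0, [/\ U0 `<=` U, U0 #<= [set: K] &
      \bigcup_(A in U0) closure A = [set: X]].

Definition finitely_non_Urysohn M : Prop :=
  M !=set0 /\
  forall F, finite_set F -> F !=set0 -> F `<=` M ->
  forall N : X -> set X, (forall x, F x -> open_nbhs x (N x)) ->
    \bigcap_(x in F) closure (N x) !=set0.

Definition nu_bound K : Prop :=
  forall M, finitely_non_Urysohn M -> M #<= [set: K].

Lemma kappa_exists : exists K, is_least_cardinal kappa_bound K.
Proof.
apply: (@least_cardinal_exists _ (set X + nat)%type) => [K L KL [Kinf KP]|].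
  split=> [|x]; first exact: card_eq_infinite KL Kinf.
  have [V [VK Vn VW]] := KP x.
  by exists V; split=> //; rewrite -(card_le_eqr KL).
split=> [|x]; first exact: infinite_sum_nat.
exists (closed_nbhd x); split=> // [|W [Wo Wx]]; first exact: card_le_sum_nat.
exists (closure W) => //; split; first exact: closed_closure.
by apply: filterS (@subset_closure _ W) _; exact: open_nbhs_nbhs.
Qed.

Lemma aL_exists : exists K, is_least_cardinal aL_bound K.
Proof.
apply: (@least_cardinal_exists _ (set X + nat)%type) => [K L KL [Kinf KP]|].
  split=> [|U Uo Uc]; first exact: card_eq_infinite KL Kinf.
  have [U0 [U0U U0K U0c]] := KP U Uo Uc.
  by exists U0; split=> //; rewrite -(card_le_eqr KL).
split=> [|U Uo Uc]; first exact: infinite_sum_nat.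
exists U; split=> //; first exact: card_le_sum_nat.
apply/seteqP; split=> // x _.
have [A UA Ax] : (\bigcup_(A in U) A) x by rewrite Uc.
by exists A => //; exact: subset_closure.
Qed.

Lemma nu_sup_exists : exists K, is_least_cardinal nu_bound K.
Proof.
apply: (@least_cardinal_exists _ X) => [K L KL KP M /KP|M _].
  by rewrite (card_le_eqr KL).
exact: card_leT.
Qed.

Definition kappa : Type := sval (cid kappa_exists).

Definition aL : Type := sval (cid aL_exists).

(* The supremum of a family of cardinals is its least upper bound. *)
Definition nu_sup : Type := sval (cid nu_sup_exists).

Definition nu : Type := option nu_sup.

Lemma kappaP : is_least_cardinal kappa_bound kappa.
Proof. exact: (svalP (cid kappa_exists)). Qed.

Lemma aLP : is_least_cardinal aL_bound aL.
Proof. exact: (svalP (cid aL_exists)). Qed.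

Lemma nu_supP : is_least_cardinal nu_bound nu_sup.
Proof. exact: (svalP (cid nu_sup_exists)). Qed.

End CardinalFunctions.

(* Main.v *)
Require Import Defs.
From mathcomp Require Import all_boot.
From mathcomp Require Import boolp classical_sets functions cardinality.
From mathcomp Require Import topology.

Set Implicit Arguments.
Unset Strict Implicit.
Unset Printing Implicit Defensive.

Local Open Scope classical_set_scope.
Local Open Scope card_scope.

(** Write [L] for an infinite set of size [kappa X * aL X], and [C] for
    [L -> nu X], the claimed bound.  The point [y] is in the theta-closure of
    [A] when the closure of every open neighbourhood of [y] meets [A].

    Every theta-closure of an [L]-indexed family [f] has at most [C] points
    ([card_theta_closure_range]).  Indeed, record for each point [x] of it
    which members of the family lie in which of the basic closed neighbourhoods
    [V x l].  There are at most [C] such traces.  Points with the same trace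
    form a finitely non-Urysohn set: given one basic neighbourhood for each of
    finitely many such points, the neighbourhoods of one fixed point [x] that
    carry the same indices intersect in a closed neighbourhood of [x], which holds
    some [f l], and equality of the traces puts [f l] in all the given
    neighbourhoods.  So each trace is shared by at most [nu X] points.

    Now generate a set [A] from one point, closing it under two operations
    applied to [L]-indexed families [f] in [A]: adding the theta-closure of the
    family, and, for each choice [v] of indices, adding one point outside the
    union of the [V (f l) (v l)] if that union is not [X].  Each family gives
    rise to at most [C] new points, so [A] is the set of values of well-founded
    terms with [L]-ary nodes labelled in a set of size at most [C].  Such a term
    is determined by the labels met along the finite paths in it, so there are
    at most [C ^ L = C] of them ([card_generated]).

    Finally [A] is everything ([theta_closed_setT]).  Suppose [y] is not in [A].
    Being in the theta-closure of a singleton is a symmetric relation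
    ([mem_closure_theta]), and [A] is theta-closed, so every [x] in [A] has a
    [V x l] that misses [y], while every [x] outside [A] has an open
    neighbourhood whose closure misses [A].  By the definition of [aL], the
    closures of at most [L] of these sets cover [X].  The basic neighbourhoods
    among them cover [A] and miss [y], so [A] contains a point outside their
    union, a contradiction.

    The cardinal arithmetic rests on [T * T <= T] for infinite [T]
    ([card_square]), proved with Zorn's lemma. *)

(** * Comparing cardinals *)

Lemma card_leTP (T U : Type) :
  [set: T] #<= [set: U] <-> exists f : T -> U, injective f.
Proof.
split=> [/card_leP[f]|[f]]; last exact: inj_card_leT.
exists (fun x => set_val (f (exist _ x (mem_setT x)))) => x y /val_inj.
by move=> /(inj (mem_set I) (mem_set I)) [].
Qed.

(** A total function is easier to compose than an injection between subtypes;
    the element of [U] serves for its values off [A]. *)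
Lemma card_le_inj (T U : Type) (A : set T) (B : set U) : U -> A #<= B ->
  exists f : T -> U, (forall x, A x -> B (f x)) /\
    forall x y, A x -> A y -> f x = f y -> x = y.
Proof.
move=> u0 /card_leP[g].
have /choice[f fP] x :
    exists u, forall Ax : A x, u = set_val (g (exist _ x (mem_set Ax))).
  have [Ax|nAx] := pselect (A x); last by exists u0.
  exists (set_val (g (exist _ x (mem_set Ax)))) => Ax'.
  by congr (set_val (g (exist _ _ _))); exact: Prop_irrelevance.
exists f; split=> [x Ax|x y Ax Ay]; first by rewrite (fP _ Ax); exact: set_valP.
rewrite (fP _ Ax) (fP _ Ay) => /val_inj.
by move=> /(inj (mem_set I) (mem_set I)) [].
Qed.

Lemma card_le_range (T K : Type) (A : set T) :
  A #<= [set: K] -> A !=set0 -> exists f : K -> T, range f = A.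
Proof.
move=> AK [a0 Aa0].
have [k0] : inhabited K.
  by have /card_leP[f] := AK; split;
    exact: set_val (f (exist _ a0 (mem_set Aa0))).
have [g [_ ginj]] := card_le_inj k0 AK.
have /choice[f fP] k : exists t, A t /\ forall a, A a -> g a = k -> t = a.
  have [[a Aa <-]|nk] := pselect (exists2 a, A a & g a = k).
    by exists a; split=> // b Ab /esym /ginj ->.
  by exists a0; split=> // a Aa ak; case: nk; exists a.
exists f; apply/seteqP; split=> [_ [k _ <-]|a Aa]; first exact: (fP k).1.
by exists (g a) => //; exact: (fP (g a)).2.
Qed.

Lemma card_le_fibers (T U S : Type) (A : set T) (p : T -> U) : S ->
  (forall u, A `&` p @^-1` [set u] #<= [set: S]) -> A #<= [set: U * S].
Proof.
move=> s0 fib.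
have /choice[g gP] u := card_le_inj s0 (fib u).
apply/card_subP; exists ((fun x => (p x, g (p x) x)) @` A) => //.
apply: inj_card_eq => x y /set_mem Ax /set_mem Ay [pxy].
by rewrite -pxy; apply: (gP (p x)).2; split.
Qed.

Lemma card_le_prod (T T' U U' : Type) : [set: T] #<= [set: T'] ->
  [set: U] #<= [set: U'] -> [set: T * U] #<= [set: T' * U'].
Proof.
move=> /card_leTP[f finj] /card_leTP[g ginj].
apply: (@inj_card_leT _ _ (fun x => (f x.1, g x.2))) => -[a b] [c d].
by case=> /finj -> /ginj ->.
Qed.

Lemma card_le_fun (T T' U U' : Type) : U' -> [set: T] #<= [set: T'] ->
  [set: U] #<= [set: U'] -> [set: T -> U] #<= [set: T' -> U'].
Proof.
move=> u0 /card_leTP[f finj] /card_leTP[g ginj].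
have /choice[ext extP] (h : T -> U) :
    exists e : T' -> U', forall t, e (f t) = g (h t).
  suff /choice[e eP] t' : exists u, forall t, f t = t' -> u = g (h t).
    by exists e => t; exact: eP.
  have [[t <-]|nt] := pselect (exists t, f t = t').
    by exists (g (h t)) => s /finj ->.
  by exists u0 => t ft; case: nt; exists t.
apply: (@inj_card_leT _ _ ext) => h k hk; apply/funext => t; apply: ginj.
by rewrite -!extP hk.
Qed.

(** * The square of an infinite cardinal *)

Section Square.
Variable T : Type.
Implicit Types (F : set (T * T * T)) (D E : set T).

Let field F : set T := [set a | exists c, F (a, a, c)].

(** Graphs of injections [D * D -> D].  The domain [D] is read off the diagonal,
    so that Zorn's lemma can be applied to plain sets ordered by inclusion.
    Requiring two points in a nonempty [D] lets the proof code a sum of two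
    copies of [D] into [D * D]; it also excludes the one-point [D], where such
    a graph exists although [D] is finite. *)
Let square_graph F :=
  [/\ forall p c c', F (p, c) -> F (p, c') -> c = c',
      forall p p' c, F (p, c) -> F (p', c) -> p = p',
      forall a b c, F (a, b, c) -> [/\ field F a, field F b & field F c],
      forall a b, field F a -> field F b -> exists c, F (a, b, c) &
      field F !=set0 -> exists a b, [/\ field F a, field F b & a <> b]].

Let fieldS F F' : F `<=` F' -> field F `<=` field F'.
Proof. by move=> sF a [c /sF]; exists c. Qed.

Let square_graph_max :
  exists F, square_graph F /\ forall F', F `<` F' -> ~ square_graph F'.
Proof.
apply: Zorn_bigcup => C sqC totC.
have sub F : C F -> F `<=` \bigcup_(F in C) F by move=> CF x Fx; exists F.
split.
- move=> p c c' [F CF Fc] [G CG Gc].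
  have [FG|GF] := totC _ _ CF CG.
    by have [+ _ _ _ _] := sqC _ CG; apply; [exact: FG Fc|exact: Gc].
  by have [+ _ _ _ _] := sqC _ CF; apply; [exact: Fc|exact: GF Gc].
- move=> p p' c [F CF Fc] [G CG Gc].
  have [FG|GF] := totC _ _ CF CG.
    by have [_ + _ _ _] := sqC _ CG; apply; [exact: FG Fc|exact: Gc].
  by have [_ + _ _ _] := sqC _ CF; apply; [exact: Fc|exact: GF Gc].
- move=> a b c [F CF Fc]; have [_ _ /(_ _ _ _ Fc)[? ? ?] _ _] := sqC _ CF.
  by split; apply: fieldS (sub _ CF) _ _.
- move=> a b [c [F CF Fc]] [d [G CG Gd]].
  have [FG|GF] := totC _ _ CF CG.
    have [_ _ _ tot _] := sqC _ CG.
    have [||e Ge] := tot a b; last by exists e; exists G.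
      by exists c; exact: FG.
    by exists d.
  have [_ _ _ tot _] := sqC _ CF.
  have [||e Fe] := tot a b; last by exists e; exists F.
    by exists c.
  by exists d; exact: GF.
- move=> [a [c [F CF Fc]]]; have [_ _ _ _ two] := sqC _ CF.
  have [|x [y [Fx Fy xy]]] := two; first by exists a; exists c.
  by exists x, y; split=> //; apply: fieldS (sub _ CF) _ _.
Qed.

(** Any injection [h] of [(D + E) * (D + E)] into [E] enlarges the graph: use
    [h] on the pairs outside [D * D], where its values in [E] cannot collide
    with the old ones. *)
Let square_graph_extend F D E (h : T -> T -> T) : square_graph F ->
  D = field F ->
  (forall a, D a -> ~ E a) ->
  (exists a b, [/\ E a, E b & a <> b]) ->
  (forall a b, (D `|` E) a -> (D `|` E) b -> E (h a b)) ->
  (forall a b c d, (D `|` E) a -> (D `|` E) b -> (D `|` E) c -> (D `|` E) d ->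
     h a b = h c d -> (a, b) = (c, d)) ->
  exists F', F `<` F' /\ square_graph F'.
Proof.
move=> [Ffun Finj Fsub Ftot Ftwo] DE dis [e1 [e2 [Ee1 Ee2 e12]]] hE hinj.
pose G : set (T * T * T) := [set u | [/\ (D `|` E) u.1.1, (D `|` E) u.1.2,
   ~ (D u.1.1 /\ D u.1.2) & u.2 = h u.1.1 u.1.2]].
have FD a b c : F (a, b, c) -> [/\ D a, D b & D c] by rewrite DE; exact: Fsub.
have DU a : D a -> (D `|` E) a by left.
have EU a : E a -> (D `|` E) a by right.
have fE : field (F `|` G) = D `|` E.
  apply/seteqP; split=> a.
    by move=> [c [/FD[]|[]]] //; left.
  case=> [|Ea]; first by rewrite DE => -[c Fc]; exists c; left.
  exists (h a a); right; split=> //=; try exact: EU.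
  by move=> [/dis].
exists (F `|` G); split.
  split; first exact: subsetUl.
  move=> /(_ (e1, e1, h e1 e1)) GF.
  suff /GF/FD[/dis] : (F `|` G) (e1, e1, h e1 e1) by [].
  right; split=> //=; try exact: EU.
  by move=> [/dis].
rewrite /square_graph fE; split.
- move=> [a b] c c' [Fc|[/= ? ? nab ->]] [Fc'|[/= ? ? nab' ->]] //.
  + exact: Ffun Fc Fc'.
  + by have [? ? _] := FD _ _ _ Fc; case: nab'.
  + by have [? ? _] := FD _ _ _ Fc'; case: nab.
- move=> [a b] [c d] e [Fc|[/= ? ? nab ee]] [Fc'|[/= ? ? nab' ee']] //.
  + exact: Finj Fc Fc'.
  + by have [_ _ /dis] := FD _ _ _ Fc; rewrite ee'; case; exact: hE.
  + by have [_ _ /dis] := FD _ _ _ Fc'; rewrite ee; case; exact: hE.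
  + by apply: hinj; rewrite // -ee.
- move=> a b c [/FD[]|[/= ? ? _ ->]]; first by split; exact: DU.
  by split=> //; apply: EU; exact: hE.
- move=> a b Ua Ub; have [[Da Db]|nab] := pselect (D a /\ D b); last first.
    by exists (h a b); right.
  by have [||c Fc] := Ftot a b; rewrite -?DE//; exists c; left.
- by move=> _; exists e1, e2; split=> //; exact: EU.
Qed.

(** Take a maximal injection [m : D * D -> D].  If the complement of [D] embeds
    in [D], then [T] embeds in two copies of [D], hence in [D * D] and in [D],
    and [m] gives the result.  Otherwise the complement contains a copy [E] of [D],
    and [D + E] embeds in [D] in the same way, so that [m] maps the square of
    [D + E] to [D], hence to [E], which contradicts maximality. *)
Lemma card_square : infinite_set [set: T] -> [set: T * T] #<= [set: T].
Proof.
move=> /infiniteP /card_leTP[n ninj].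
have [F [sqF maxF]] := square_graph_max.
have [Ffun Finj Fsub Ftot Ftwo] := sqF.
set D := field F in Fsub Ftot Ftwo.
have [D0|nD0] := pselect (D !=set0); last first.
  exfalso.
  (* The empty graph is not maximal: a copy of [nat] in [T] extends it. *)
  have /choice[r rP] x : exists k, range n x -> n k = x.
    have [[k _ <-]|nx] := pselect (range n x); first by exists k.
    by exists 0.
  have [|||| F' [/maxF]//] := @square_graph_extend F D (range n)
    (fun a b => n (pickle (r a, r b))) sqF erefl.
  - by move=> a Da; case: nD0; exists a.
  - by exists (n 0), (n 1); split=> // /ninj.
  - by move=> a b _ _; exists (pickle (r a, r b)).
  - have nU a : (D `|` range n) a -> n (r a) = a.
      by case=> [Da|/rP //]; case: nD0; exists a.
    move=> a b c d Ua Ub Uc Ud /ninj /(pcan_inj pickleK)[rac rbd].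
    by rewrite -(nU a)// -(nU b)// rac rbd !nU.
have [d0 [d1 [Dd0 Dd1 d01]]] := Ftwo D0.
have /choice[m mP] (p : T * T) : exists c, D p.1 -> D p.2 -> F (p, c).
  have [[D1 D2]|nD] := pselect (D p.1 /\ D p.2); last first.
    by exists d0 => ? ?; case: nD.
  by have [c] := Ftot _ _ D1 D2; exists c; rewrite (surjective_pairing p).
have mD a b : D a -> D b -> D (m (a, b)).
  by move=> Da Db; have /Fsub[] := mP (a, b) Da Db.
have minj a b c d : D a -> D b -> D c -> D d ->
    m (a, b) = m (c, d) -> (a, b) = (c, d).
  move=> Da Db Dc Dd e; apply: (Finj _ _ (m (a, b)) (mP (a, b) Da Db)).
  by rewrite e; exact: (mP (c, d)).
(* Two copies of [D] fit in [D], with [d0] and [d1] as tags; [k] sends the part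
   of [S] outside [D] to the second copy. *)
have codeP (S : set T) (k : T -> T) : (forall a, S a -> ~ D a -> D (k a)) ->
    (forall a b, S a -> S b -> ~ D a -> ~ D b -> k a = k b -> a = b) ->
    exists j : T -> T, (forall a, S a -> D (j a)) /\
      forall a b, S a -> S b -> j a = j b -> a = b.
  move=> kD kinj.
  exists (fun a => if pselect (D a) then m (d0, a) else m (d1, k a)).
  split=> [a Sa|a b Sa Sb].
    case: pselect => Da; apply: mD => //; exact: kD.
  have kDa := kD a Sa; have kDb := kD b Sb.
  case: pselect => Da; case: pselect => Db e.
  - by have [] := minj _ _ _ _ Dd0 Da Dd0 Db e.
  - by have [/d01] := minj _ _ _ _ Dd0 Da Dd1 (kDb Db) e.
  - by have [/esym/d01] := minj _ _ _ _ Dd1 (kDa Da) Dd0 Db e.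
  - by have [/kinj] := minj _ _ _ _ Dd1 (kDa Da) Dd1 (kDb Db) e; apply.
have DND : D #<= ~` D \/ ~` D #<= D.
  have := card_le_total D (~` D).
  by rewrite !(card_le_eql (card_setT _)) !(card_le_eqr (card_setT _)).
case: DND => /(card_le_inj d0)[k [kN kinj]]; last first.
  have [||j [jD jinj]] := codeP setT k.
  - by move=> a _; exact: kN.
  - by move=> a b _ _; exact: kinj.
  apply: (@inj_card_leT _ _ (fun p => m (j p.1, j p.2))) => -[a b] [c d] /=.
  move=> e; have [] := minj _ _ _ _ (jD a I) (jD b I) (jD c I) (jD d I) e.
  by move=> /jinj -> // /jinj -> //.
pose E := k @` D.
have /choice[r rP] x : exists y, E x -> D y /\ k y = x.
  have [[y Dy <-]|nx] := pselect (E x); first by exists y.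
  by exists d0.
have UE a : (D `|` E) a -> ~ D a -> E a by case.
have [||j [jD jinj]] := codeP (D `|` E) r.
- by move=> a Ua Da; have [] := rP _ (UE _ Ua Da).
- move=> a b Ua Ub Da Db.
  have [_ {2}<-] := rP _ (UE _ Ua Da).
  by have [_ {2}<-] := rP _ (UE _ Ub Db) => ->.
have [|||| F' [/maxF]//] := @square_graph_extend F D E
    (fun a b => k (m (j a, j b))) sqF erefl.
- by move=> a Da [b Db kba]; apply: (kN b) => //; rewrite kba.
- exists (k d0), (k d1).
  by split; [exists d0|exists d1|move=> /kinj; auto].
- by move=> a b Ua Ub; exists (m (j a, j b)) => //; apply: mD; exact: jD.
- move=> a b c d Ua Ub Uc Ud e.
  have jj x y : (D `|` E) x -> (D `|` E) y -> D (m (j x, j y)).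
    by move=> Ux Uy; apply: mD; exact: jD.
  have e' := kinj _ _ (jj a b Ua Ub) (jj c d Uc Ud) e.
  have [] := minj _ _ _ _ (jD a Ua) (jD b Ub) (jD c Uc) (jD d Ud) e'.
  by move=> /jinj -> // /jinj ->.
Qed.

End Square.

(** * Infinite exponents *)

(** A sequence is coded by its length and by an iterated pairing, which is
    injective on sequences of a given length. *)
Lemma card_seq (T : Type) : infinite_set [set: T] -> [set: seq T] #<= [set: T].
Proof.
move=> Tinf; have /card_leTP[m minj] := card_square Tinf.
have /infiniteP natT := Tinf; have [t0 _] := infinite_setN0 Tinf.
apply: card_le_trans (card_square Tinf).
apply: card_le_trans (card_le_prod natT (card_lexx [set: T])).
apply: (@inj_card_leT _ _
  (fun s => (size s, foldr (fun x y => m (x, y)) t0 s))) => s t [].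
elim: s t => [|x s IHs] [|y t] //= [st] /minj [-> fst].
by rewrite (IHs t).
Qed.

Section Exponential.
Variables (L M : Type) (m0 m1 : M).
Hypotheses (Linf : infinite_set [set: L]) (m01 : m0 <> m1).

Local Notation C := (L -> M).

Let c0 : C := fun=> m0.

Lemma card_le_Prop : [set: Prop] #<= [set: M].
Proof.
apply: (@inj_card_leT _ _ (fun P => if `[< P >] then m0 else m1)) => P Q.
by case: asboolP => p; case: asboolP => q e; [| by case: m01 | by case: m01 |];
  exact/propext.
Qed.

Lemma card_base_le_exp : [set: M] #<= [set: C].
Proof.
have [l _] := infinite_setN0 Linf.
by apply: (@inj_card_leT _ _ (fun m _ => m)) => m m' /(congr1 (@^~ l)).
Qed.

Lemma card_expo_le_exp : [set: L] #<= [set: C].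
Proof.
apply: (@inj_card_leT _ _ (fun l l' => if pselect (l = l') then m0 else m1)).
move=> l l' /(congr1 (@^~ l')) /=.
by case: pselect => // ll'; case: pselect => // l'l' /esym.
Qed.

Lemma card_exp_exp : [set: L -> C] #<= [set: C].
Proof.
apply: card_le_trans (card_le_fun m0 (card_square Linf) (card_lexx [set: M])).
apply: (@inj_card_leT _ _ (fun h p => h p.1 p.2)) => h k hk.
by apply/funext => l; apply/funext => l'; have := congr1 (@^~ (l, l')) hk.
Qed.

Lemma card_exp_le (T U : Type) : [set: T] #<= [set: L] ->
  [set: U] #<= [set: C] -> [set: T -> U] #<= [set: C].
Proof.
by move=> TL UC; apply: card_le_trans (card_le_fun c0 TL UC) card_exp_exp.
Qed.

Lemma card_sum_exp (T U : Type) : [set: T] #<= [set: C] ->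
  [set: U] #<= [set: C] -> [set: T + U] #<= [set: C].
Proof.
move=> /card_leTP[f finj] /card_leTP[g ginj].
apply: card_le_trans card_exp_exp.
have [l0 [l1 l01]] : exists l0 l1 : L, l0 <> l1.
  have /infiniteP /card_leTP[n ninj] := Linf.
  by exists (n 0), (n 1) => /ninj.
(* The value at [l0] is a tag for the summand, the one at [l1] the element. *)
pose code (x : T + U) l : C :=
  if pselect (l = l0) then fun=> if x is inl _ then m0 else m1
  else match x with inl t => f t | inr u => g u end.
apply: (@inj_card_leT _ _ code) => x y xy.
have := congr1 (fun h => h l0 l0) xy; have := congr1 (@^~ l1) xy.
rewrite /code; case: pselect => [/esym//|l10]; case: pselect => // l00.
case: x y {xy} => [t|u] [t'|u']; first by move=> /finj ->.
- by [].
- by move=> _ /esym.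
- by move=> /ginj ->.
Qed.

Lemma card_prod_exp (T U : Type) : [set: T] #<= [set: C] ->
  [set: U] #<= [set: C] -> [set: T * U] #<= [set: C].
Proof.
move=> TC UC; apply: card_le_trans (card_le_prod TC UC) _.
apply: (@card_le_trans _ _ _ [set: bool -> C]).
  apply: (@inj_card_leT _ _ (fun p b => if b then p.1 else p.2)).
  move=> [a b] [c d] e.
  by congr pair; [have := congr1 (@^~ true) e|have := congr1 (@^~ false) e].
apply: card_exp_le (card_lexx _).
have /infiniteP := Linf; apply: card_le_trans.
exact: countableP.
Qed.

End Exponential.

(** * The set generated by operations of infinite arity *)

Section Generated.
Variables (L X D : Type) (x0 : X) (op : D -> (L -> X) -> X).

Inductive term := Base | Apply of D & (L -> term).

Fixpoint term_value t : X :=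
  if t is Apply d s then op d (fun l => term_value (s l)) else x0.

(** The symbol at the node that the path [p] leads to; [None] stands both for
    [Base] and for the paths that leave the term. *)
Fixpoint label t (p : seq L) : option D :=
  match t, p with
  | Base, _ => None
  | Apply d _, [::] => Some d
  | Apply _ s, l :: p => label (s l) p
  end.

Lemma label_inj : injective label.
Proof.
elim=> [|d s IHs] [|e t] // st.
- by have := congr1 (@^~ [::]) st.
- by have := congr1 (@^~ [::]) st.
- have /= [->] := congr1 (@^~ [::]) st.
  congr Apply; apply/funext => l; apply: IHs; apply/funext => p.
  by have := congr1 (@^~ (l :: p)) st.
Qed.

(** A term is determined by its labelling, a function from [seq L], which is no
    larger than [L], to [option D]. *)
Lemma card_generated (M : Type) (m0 m1 : M) : m0 <> m1 ->
  infinite_set [set: L] -> [set: D] #<= [set: L -> M] ->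
  range term_value #<= [set: L -> M].
Proof.
move=> m01 Linf DC; apply: card_le_trans (card_image_le _ _) _.
apply: (card_le_trans (inj_card_leT label_inj)).
apply: (card_exp_le m0 Linf (card_seq Linf)).
apply: (@card_le_trans _ _ _ [set: unit + D]).
  apply: (@inj_card_leT _ _ (fun o => if o is Some d then inr d else inl tt)).
  by move=> [d|] [e|] // [->].
apply: (card_sum_exp Linf m01 _ DC).
by apply: (@inj_card_leT _ _ (fun _ _ => m0)) => -[] [].
Qed.

Lemma generated_base : range term_value x0.
Proof. by exists Base. Qed.

Lemma generated_op d f :
  (forall l, range term_value (f l)) -> range term_value (op d f).
Proof.
move=> fgen; have /choice[s sf] l : exists t, term_value t = f l.
  by have [t _ tf] := fgen l; exists t.
by exists (Apply d s) => //=; congr op; apply/funext.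
Qed.

End Generated.

(** * Theta-closure and closed neighbourhood bases *)

Definition theta_closure (X : topologicalType) (A : set X) : set X :=
  [set x | forall W, open_nbhs x W -> closure W `&` A !=set0].

Lemma theta_closureS (X : topologicalType) (A B : set X) :
  A `<=` B -> theta_closure A `<=` theta_closure B.
Proof. by move=> AB x Ax W /Ax[y [Wy /AB By]]; exists y. Qed.

Lemma subset_theta_closure (X : topologicalType) (A : set X) :
  A `<=` theta_closure A.
Proof.
by move=> x Ax W [_ Wx]; exists x; split=> //; exact: subset_closure.
Qed.

(** Both sides say that [x] and [y] have no disjoint open neighbourhoods, a
    symmetric relation.  This stands in for Hausdorff separation in
    [theta_closed_setT]. *)
Lemma mem_closure_theta (X : topologicalType) (x y : X) :
  (forall W, open_nbhs x W -> closure W y) -> theta_closure [set x] y.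
Proof.
move=> xy W yW; exists x; split=> // U Ux.
have /xy yU : open_nbhs x U^° .
  by split; [exact: open_interior|].
have [z [Uz Wz]] := yU W (open_nbhs_nbhs yW).
by exists z; split=> //; exact: interior_subset Uz.
Qed.

Section Bound.
Variables (X : topologicalType) (L S : Type).

(** Indexing every base by the same [L] makes the traces of distinct points
    comparable. *)
Lemma kappa_base : kappa_bound X L ->
  exists V : X -> L -> set X,
    (forall x l, closed_nbhd x (V x l)) /\
    (forall x W, open_nbhs x W -> exists l, V x l `<=` closure W).
Proof.
move=> [_ kap].
suff /choice[V VP] x : exists V : L -> set X, (forall l, closed_nbhd x (V l)) /\
    forall W, open_nbhs x W -> exists l, V l `<=` closure W.
  by exists V; split=> x; have [] := VP x.
have [V [VL Vn VW]] := kap x.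
have [|v vV] := card_le_range VL.
  have [|F VF _] := VW setT; last by exists F.
  by split; [exact: openT|].
have inV l : V (v l) by rewrite -vV; exists l.
exists v; split=> [l|W /VW[F]]; first exact: Vn.
by rewrite -vV => -[l _ <-]; exists l.
Qed.

Variable V : X -> L -> set X.
Hypothesis Vnbhd : forall x l, closed_nbhd x (V x l).
Hypothesis Vbase : forall x W, open_nbhs x W -> exists l, V x l `<=` closure W.

(** * Counting the points of a theta-closure *)

(** For a fixed [x] in [F], the sets [V x (i y)] with [y] in [F] intersect in a
    closed neighbourhood of [x], hence contain a common [f l]; since [x] and [y] have
    the same trace, [f l] is then in [V y (i y)] for every [y]. *)
Lemma finitely_non_Urysohn_trace (f : L -> X) (t : L -> L -> Prop) :
  let M := theta_closure (range f) `&`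
    [set x | (fun l l' => V x l (f l')) = t] in
  M !=set0 -> finitely_non_Urysohn M.
Proof.
move=> M M0; split=> // F Ffin [x Fx] FM N Nnbhd.
have /choice[i iN] y : exists l, F y -> V y l `<=` closure (N y).
  have [Fy|nFy] := pselect (F y); last first.
    have [|l _] := @Vbase y setT; last by exists l.
    by split; [exact: openT|].
  by have [l Vl] := Vbase (Nnbhd y Fy); exists l.
have [thx trx] := FM x Fx.
pose W := (\bigcap_(y in F) V x (i y))^°.
have xW : open_nbhs x W.
  split; first exact: open_interior.
  have [D FD] := finite_fsetP.1 Ffin; rewrite /W FD.
  by apply: filter_bigI => y _; exact: (Vnbhd x (i y)).2.
have [_ [/[swap] -[l _ <-] clz]] := thx W xW.
exists (f l) => y Fy; apply: iN => //.
have [_ try] := FM y Fy.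
suff : V x (i y) (f l).
  by have := congr1 (fun t => t (i y) l) (etrans trx (esym try)) => /= ->.
have [cl _] := Vnbhd x (i y); rewrite [V _ _](closure_id _).1 //.
by apply: closure_subset clz => z /interior_subset; exact.
Qed.

(** The traces are at most [2 ^ (L * L)] many, and each is shared by at most [S]
    points. *)
Lemma card_theta_closure_range (f : L -> X) : S ->
  infinite_set [set: L] -> nu_bound X S ->
  theta_closure (range f) #<= [set: L -> option S].
Proof.
move=> s0 Linf nuS.
have m01 : None <> Some s0 by [].
have base := card_base_le_exp (option S) Linf.
have expL := card_exp_le None Linf (card_lexx [set: L]).
apply: (@card_le_trans _ _ _ [set: (L -> L -> Prop) * S]).
  apply: (card_le_fibers (p := fun x l l' => V x l (f l')) s0) => t.
  have [M0|M0] := pselect (theta_closure (range f) `&`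
    [set x | (fun l l' => V x l (f l')) = t] !=set0).
    exact/nuS/finitely_non_Urysohn_trace.
  have -> : theta_closure (range f) `&`
    (fun x l l' => V x l (f l')) @^-1` [set t] = set0.
    by apply/seteqP; split=> // x Mx; case: M0; exists x.
  exact: card_ge0.
apply: (card_prod_exp None Linf).
  exact: (expL _ _ (expL _ _ (card_le_trans (card_le_Prop m01) base))).
by apply: card_le_trans base; apply: (@inj_card_leT _ _ some) => s s' [].
Qed.

(** * Almost Lindelof covers *)

(** The hypothesis on [f] and [v] says that [A] escapes from every union of at
    most [L] basic neighbourhoods of its points that is not all of [X].  For [y]
    outside [A], such a union is obtained by covering [X] with two kinds of open
    sets: [inner] ones, around the points of [A], have closures missing [y], and
    [outer] ones, around the other points, have closures missing [A]. *)
Lemma theta_closed_setT (A : set X) : aL_bound X L -> A !=set0 ->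
  theta_closure A `<=` A ->
  (forall (f : L -> X) (v : L -> L), (forall l, A (f l)) ->
    ~` (\bigcup_l V (f l) (v l)) !=set0 ->
    exists2 z, A z & ~ (\bigcup_l V (f l) (v l)) z) ->
  [set: X] = A.
Proof.
move=> [_ aLL] [a0 Aa0] Atheta esc.
apply/seteqP; split=> // y _; apply: contrapT => nAy.
pose inner B := exists x l, [/\ A x, ~ V x l y & B = (V x l)^°].
pose outer B := open B /\ closure B `&` A = set0.
have [||U [UU UL Ucov]] := aLL [set B | inner B \/ outer B].
- by move=> B [[x [l [_ _ ->]]]|[]//]; exact: open_interior.
- apply/seteqP; split=> // z _.
  have [Az|nAz] := pselect (A z).
    have /existsNP[W /not_implyP[zW nWy]] :
        ~ (forall W, open_nbhs z W -> closure W y).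
      move=> /mem_closure_theta yz; apply: nAy; apply: Atheta.
      by apply: theta_closureS yz => _ ->.
    have [l Vl] := Vbase zW; exists (V z l)^°; last exact: (Vnbhd z l).2.
    by left; exists z, l; split=> // /Vl.
  have /existsNP[W /not_implyP[zW nW]] : ~ theta_closure A z.
    by move=> /Atheta.
  exists W; last by case: zW.
  right; split; first by case: zW.
  by apply/seteqP; split=> // a Wa; apply: nW; exists a.
have cover z : exists2 B, U B & closure B z.
  have : (\bigcup_(B in U) closure B) z by rewrite Ucov.
  by move=> [B]; exists B.
have coverA z : A z -> exists B, [/\ U B, inner B & closure B z].
  move=> Az; have [B UB Bz] := cover z; exists B; split=> //.
  have [//|[_ BA]] := UU _ UB.
  by have : (closure B `&` A) z by []; rewrite BA.
have [g gU] : exists g : L -> set X, range g = U `&` inner.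
  apply: card_le_range.
    exact: card_le_trans (subset_card_le (@subIsetl _ U inner)) UL.
  by have [B [? ? _]] := coverA a0 Aa0; exists B.
have /choice[fv fvP] l : exists xl : X * L,
    [/\ A xl.1, ~ V xl.1 xl.2 y & g l = (V xl.1 xl.2)^°].
  have [_ [x [i [? ? ?]]]] : (U `&` inner) (g l) by rewrite -gU; exists l.
  by exists (x, i).
have [||z Az nz] := esc (fun l => (fv l).1) (fun l => (fv l).2).
- by move=> l; have [] := fvP l.
- by exists y => -[l _ /=]; have [] := fvP l.
have [B [UB innerB Bz]] := coverA z Az.
have [l _ gl] : range g B by rewrite gU.
apply: nz; exists l => //.
have [_ _ glV] := fvP l; have [cl _] := Vnbhd (fv l).1 (fv l).2.
rewrite [V _ _](closure_id _).1 //.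
apply: closure_subset (@interior_subset _ _) _ _.
by rewrite -glV gl.
Qed.

(** * The cardinal inequality *)

(** [theta_closed_setT] applies to the set generated from one point by the
    enumerations of theta-closures of families and by the choices of points
    outside unions of basic neighbourhoods. *)
Lemma card_le_exp_nu : infinite_set [set: L] -> aL_bound X L -> nu_bound X S ->
  [set: X] #<= [set: L -> option S].
Proof.
move=> Linf aLL nuS.
have [[x0 _]|X0] := pselect ([set: X] !=set0); last first.
  have -> : [set: X] = set0 by apply/seteqP; split=> // x _; case: X0; exists x.
  exact: card_ge0.
have [l0 _] := infinite_setN0 Linf.
(* Singletons are finitely non-Urysohn, so the base [nu X] is at least 2. *)
have [s0] : inhabited S.
  have /nuS : finitely_non_Urysohn [set x0].
    split=> [|F _ [x Fx] F1 N NF]; first by exists x0.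
    exists x0 => y Fy; have -> : x0 = y by have := F1 y Fy.
    by apply: subset_closure; have [] := NF y Fy.
  move=> /card_leP[g].
  by split; exact: set_val (g (exist _ x0 (mem_set erefl))).
have m01 : None <> Some s0 by [].
pose C := L -> option S.
have /choice[enum enumP] (f : L -> X) :
    exists e : C -> X, range e = theta_closure (range f).
  apply: card_le_range; first exact: card_theta_closure_range.
  by exists (f l0); apply: subset_theta_closure; exists l0.
pose free (f : L -> X) (v : L -> L) : set X := ~` (\bigcup_l V (f l) (v l)).
have /choice[pick pickP] (fv : (L -> X) * (L -> L)) :
    exists x, free fv.1 fv.2 !=set0 -> free fv.1 fv.2 x.
  have [[x fx]|nf] := pselect (free fv.1 fv.2 !=set0); first by exists x.
  by exists x0.
pose op (d : C + (L -> L)) (f : L -> X) :=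
  match d with inl c => enum f c | inr v => pick (f, v) end.
pose A := range (term_value x0 op).
have AC : A #<= [set: C].
  apply: (card_generated _ _ m01 Linf).
  apply: (card_sum_exp Linf m01 (card_lexx _)).
  exact: (card_exp_le None Linf (card_lexx _) (card_expo_le_exp L m01)).
have A0 : A x0 by exact: generated_base.
have Aop d f : (forall l, A (f l)) -> A (op d f) by exact: generated_op.
have Atheta : theta_closure A `<=` A.
  move=> x xA.
  have /choice[f fP] l : exists y, V x l y /\ A y.
    have [clV /= intV] := Vnbhd x l.
    have [|y [cly Ay]] := xA (V x l)^°.
      by split; first exact: open_interior.
    exists y; split=> //; rewrite [V _ _](closure_id _).1 //.
    by apply: closure_subset cly; exact: interior_subset.
  have : theta_closure (range f) x.
    move=> W /Vbase[l VW]; exists (f l); split; last by exists l.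
    by apply: VW; exact: (fP l).1.
  rewrite -enumP => -[c _ <-].
  by apply: (Aop (inl c)) => l; exact: (fP l).2.
suff -> : [set: X] = A by [].
apply: theta_closed_setT => // [|f v fA fv]; first by exists x0.
by exists (pick (f, v)); [exact: (Aop (inr v)) | exact: pickP (f, v) fv].
Qed.

End Bound.

Lemma kappa_boundS (X : topologicalType) (K L : Type) :
  [set: K] #<= [set: L] -> kappa_bound X K -> kappa_bound X L.
Proof.
move=> KL [Kinf kap]; split.
  by move=> Lfin; apply: Kinf; exact: card_le_finite KL Lfin.
move=> x; have [V [VK Vn VW]] := kap x; exists V; split=> //.
exact: card_le_trans VK KL.
Qed.

Lemma aL_boundS (X : topologicalType) (K L : Type) :
  [set: K] #<= [set: L] -> aL_bound X K -> aL_bound X L.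
Proof.
move=> KL [Kinf aLK]; split.
  by move=> Lfin; apply: Kinf; exact: card_le_finite KL Lfin.
move=> U Uo Uc; have [U0 [U0U U0K U0c]] := aLK U Uo Uc; exists U0; split=> //.
exact: card_le_trans U0K KL.
Qed.

Theorem theorem6p11 (X : topologicalType) :
  [set: X] #<= [set: (kappa X * aL X)%type -> nu X].
Proof.
have [kX _] := kappaP X; have [aX _] := aLP X; have [nX _] := nu_supP X.
have [k0 _] := infinite_setN0 kX.1; have [a0 _] := infinite_setN0 aX.1.
have kL : [set: kappa X] #<= [set: kappa X * aL X].
  by apply: (@inj_card_leT _ _ (fun k => (k, a0))) => k k' [].
have aLL : [set: aL X] #<= [set: kappa X * aL X].
  by apply: (@inj_card_leT _ _ (fun a => (k0, a))) => a a' [].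
have kL' := kappa_boundS kL kX.
have [V [Vn Vb]] := kappa_base kL'.
exact: card_le_exp_nu Vn Vb kL'.1 (aL_boundS aLL aX) nX.
Qed.
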